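(* Let $F$ be a graph on vertex set $[k]$. Let $(W_n)_n$ be a sequence of graphons $W_n:\Omega^2\to[0,1]$ converging to a graphon $W$ in the cut-norm, and for each $n$ let $\mathfrak{c}_n$ be a fractional $F$-cover of $W_n$. Then every weak$^*$ accumulation point $\mathfrak{c}$ of $(\mathfrak{c}_n)_n$ is a fractional $F$-cover of $W$.
   Context: $(\Omega,\nu)$ is an atomless Borel probability space; a graphon is a symmetric measurable $W:\Omega^2\to[0,1]$. The cut-norm is $\|V\|_\square=\sup_{A,B\subset\Omega}|\int_{A\times B}V|$. Weak$^*$ convergence is in $\mathcal{L}^\infty(\Omega)$ viewed as the dual of $\mathcal{L}^1(\Omega)$: $f_n\to f$ weak$^*$ iff $\int f_ng\to\int fg$ for every $g\in\mathcal{L}^1(\Omega)$. For a graphon $W$, $W^{\otimes F}(x_1,\dots,x_k)=\prod_{ij\in E(F),i<j}W(x_i,x_j)$ and $\mathcal{F}_F(W)=\{W^{\otimes F}\neq0\}$. A fractional $F$-cover of $W$ is a measurable $\mathfrak{c}:\Omega\to[0,1]$ with $\nu^k\big(\mathcal{F}_F(W)\cap\{(x_1,\dots,x_k):\sum_{i=1}^k\mathfrak{c}(x_i)<1\}\big)=0$. *)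

(* Defs.v *)
From HB Require Import structures.
From mathcomp Require Import all_boot all_order all_algebra.
From mathcomp Require Import all_classical all_reals all_analysis.
Set Implicit Arguments. Unset Strict Implicit. Unset Printing Implicit Defensive.
Import Order.TTheory GRing.Theory Num.Theory.
Import numFieldNormedType.Exports.
Local Open Scope classical_set_scope.
Local Open Scope ring_scope.

Definition is_graph (k : nat) (F : rel 'I_k) : Prop :=
  symmetric F /\ irreflexive F.

Definition atomless {d : measure_display} {T : measurableType d} {R : realType}
  (P : probability T R) : Prop :=
  forall A : set T, measurable A -> (0 < P A)%E ->
    exists B : set T, [/\ measurable B, B `<=` A, (0 < P B)%E & (P B < P A)%E].

Definition graphon {d : measure_display} {T : measurableType d} {R : realType}
  (W : T * T -> R) : Prop :=
  [/\ measurable_fun [set: T * T] W,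
      (forall x y, W (x, y) = W (y, x)) &
      (forall z, 0 <= W z <= 1)].

Definition cut_norm {d : measure_display} {T : measurableType d} {R : realType}
  (P : probability T R) (V : T * T -> R) : \bar R :=
  ereal_sup [set y | exists A B : set T,
     [/\ measurable A, measurable B &
         y = `| \int[(P \x P)%E]_(z in A `*` B) (V z)%:E |%E ]].

(* The k-fold product measure nu^k on k.-tuples, defined by iterated
   integration (as the library defines the binary product measure \x). *)
Fixpoint tuple_pmeasure {d : measure_display} {T : measurableType d}
  {R : realType} (P : probability T R) (k : nat) : set (k.-tuple T) -> \bar R :=
  match k return set (k.-tuple T) -> \bar R with
  | 0 => fun A => if `[< A [tuple] >] then 1%E else 0%E
  | k'.+1 => fun A =>
      (\int[P]_x tuple_pmeasure P [set t : k'.-tuple T | A [tuple of x :: t]])%E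
  end.

Definition hom_density_fun {d : measure_display} {T : measurableType d}
  {R : realType} (k : nat) (F : rel 'I_k) (W : T * T -> R)
  (x : k.-tuple T) : R :=
  \prod_(i < k) \prod_(j < k | (i < j)%N && F i j) W (tnth x i, tnth x j).

Definition hom_support {d : measure_display} {T : measurableType d}
  {R : realType} (k : nat) (F : rel 'I_k) (W : T * T -> R) : set (k.-tuple T) :=
  [set x | hom_density_fun F W x != 0].

Definition frac_cover {d : measure_display} {T : measurableType d}
  {R : realType} (P : probability T R) (k : nat) (F : rel 'I_k)
  (W : T * T -> R) (c : T -> R) : Prop :=
  [/\ measurable_fun [set: T] c,
      (forall x, 0 <= c x <= 1) &
      tuple_pmeasure P (hom_support F W `&`
                        [set x | \sum_(i < k) c (tnth x i) < 1]) = 0%E].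

Definition Linfty {d : measure_display} {T : measurableType d} {R : realType}
  (P : probability T R) (c : T -> R) : Prop :=
  measurable_fun [set: T] c /\ exists M : R, {ae P, forall x, `|c x| <= M}.

(* c is a weak* accumulation point of (c_n) in L^infty = (L^1)^*:
   every basic weak* neighbourhood
   { f | |int (f - c) g_i| < eps for all i < m }, g_i in L^1,
   contains c_n for infinitely many n. *)
Definition weakstar_accumulation {d : measure_display} {T : measurableType d}
  {R : realType} (P : probability T R) (cs : nat -> T -> R) (c : T -> R) : Prop :=
  forall (m : nat) (g : 'I_m -> T -> R) (eps : R),
    (forall i, P.-integrable [set: T] (EFin \o g i)) -> 0 < eps ->
    forall N : nat, exists2 n : nat, (N <= n)%N &
      forall i, (`| \int[P]_x ((cs n x - c x) * g i x)%:E | < eps%:E)%E.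

(* Main.v *)
Require Import Defs.
From HB Require Import structures.
From mathcomp Require Import all_boot all_order all_algebra.
From mathcomp Require Import all_classical all_reals all_analysis.
From mathcomp Require Import measurable_realfun ring lra.
Import Order.TTheory GRing.Theory Num.Theory.
Import numFieldNormedType.Exports.
Local Open Scope classical_set_scope.
Local Open Scope ring_scope.

(* A cover c_n of W_n satisfies W_n^F (sum_i c_n(x_i) - 1) >= 0 almost
   everywhere.  Integrate this against the indicator of a box prod_i A_i and let
   n tend to infinity: by the counting lemma W_n^F may be replaced by W^F under
   any product weight with values in [0,1], in particular under 1_A times
   c_n(x_i), and then c_n by c, since it is tested against a fixed marginal of
   W^F 1_A.  Taking A_i = {c < q_i} with rational q_i of sum < 1, the limit
   inequality forces W^F to vanish almost everywhere on the box, and countably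
   many such boxes cover {sum_i c(x_i) < 1}.  The counting lemma switches edges
   one at a time; for the edge ij, the other factors split into one that does
   not depend on x_j and one that does not depend on x_i. *)


(** * Real integration of bounded measurable functions under a probability *)

Section bounded_measurable.
Context {d : measure_display} {T : measurableType d} {R : realType}.
Implicit Types f g : T -> R.

(** A bound valid everywhere, and not only almost everywhere, gives integrability under every
    probability and passes to all sections, so linearity and Fubini apply without further side
    conditions. *)
Definition bounded_measurable f :=
  measurable_fun [set: T] f /\ exists M : R, forall x, `|f x| <= M.

Lemma bm_cst (r : R) : bounded_measurable (fun=> r).
Proof. by split; [exact: measurable_cst|exists `|r|]. Qed.

Lemma bmD f g : bounded_measurable f -> bounded_measurable g ->
  bounded_measurable (fun x => f x + g x).
Proof.
move=> [mf [M fM]] [mg [N gN]]; split; first exact: measurable_funD.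
by exists (M + N) => x; rewrite (le_trans (ler_normD _ _))// lerD.
Qed.

Lemma bmN f : bounded_measurable f -> bounded_measurable (fun x => - f x).
Proof.
move=> [mf [M fM]]; split; first exact: measurableT_comp.
by exists M => x; rewrite normrN.
Qed.

Lemma bmB f g : bounded_measurable f -> bounded_measurable g ->
  bounded_measurable (fun x => f x - g x).
Proof. by move=> bf /bmN; exact: bmD. Qed.

Lemma bmM f g : bounded_measurable f -> bounded_measurable g ->
  bounded_measurable (fun x => f x * g x).
Proof.
move=> [mf [M fM]] [mg [N gN]]; split; first exact: measurable_funM.
by exists (M * N) => x; rewrite normrM ler_pM.
Qed.

Lemma bm_norm f : bounded_measurable f -> bounded_measurable (fun x => `|f x|).
Proof.
move=> [mf [M fM]]; split; first exact: measurableT_comp.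
by exists M => x; rewrite normr_id.
Qed.

Lemma bm_sum (I : Type) (s : seq I) (F : I -> T -> R) :
  (forall i, bounded_measurable (F i)) ->
  bounded_measurable (fun x => \sum_(i <- s) F i x).
Proof.
move=> bF; elim: s => [|i s IHs].
  by under eq_fun do rewrite big_nil; exact: bm_cst.
by under eq_fun do rewrite big_cons; exact: bmD.
Qed.

Lemma bm_indic (A : set T) : measurable A -> bounded_measurable (\1_A).
Proof.
move=> mA; split; first exact: measurable_indic.
by exists 1 => x; rewrite indicE; case: (x \in A); rewrite ?normr1 ?normr0.
Qed.

Lemma bm_unit f : measurable_fun [set: T] f -> (forall x, 0 <= f x <= 1) ->
  bounded_measurable f.
Proof.
move=> mf f01; split=> //; exists 1 => x; have /andP[f0 f1] := f01 x.
by rewrite ger0_norm.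
Qed.

Lemma bm_integrable (P : probability T R) f :
  bounded_measurable f -> P.-integrable [set: T] (EFin \o f).
Proof.
move=> [mf [M fM]]; apply: measurable_bounded_integrable => //.
  by rewrite (le_lt_trans (probability_le1 _ _))// ltry.
exists M; split; first exact: num_real.
by move=> y My x _; exact/(le_trans (fM x))/ltW.
Qed.

Lemma bm_EFin_Rintegral (P : probability T R) f : bounded_measurable f ->
  (\int[P]_x f x)%:E = (\int[P]_x (f x)%:E)%E.
Proof.
move=> bf; rewrite fineK//; apply: integrable_fin_num => //.
exact: bm_integrable.
Qed.

Lemma bm_RintegralD (P : probability T R) f g :
  bounded_measurable f -> bounded_measurable g ->
  \int[P]_x (f x + g x) = \int[P]_x f x + \int[P]_x g x.
Proof. by move=> *; rewrite RintegralD//; exact: bm_integrable. Qed.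

Lemma bm_RintegralB (P : probability T R) f g :
  bounded_measurable f -> bounded_measurable g ->
  \int[P]_x (f x - g x) = \int[P]_x f x - \int[P]_x g x.
Proof. by move=> *; rewrite RintegralB//; exact: bm_integrable. Qed.

Lemma bm_RintegralZl (P : probability T R) (r : R) f : bounded_measurable f ->
  \int[P]_x (r * f x) = r * \int[P]_x f x.
Proof. by move=> *; rewrite RintegralZl//; exact: bm_integrable. Qed.

Lemma bm_Rintegral_sum (P : probability T R) (I : Type) (s : seq I)
    (F : I -> T -> R) : (forall i, bounded_measurable (F i)) ->
  \int[P]_x (\sum_(i <- s) F i x) = \sum_(i <- s) \int[P]_x F i x.
Proof.
move=> bF; elim: s => [|i s IHs].
  under eq_Rintegral do rewrite big_nil.
  by rewrite big_nil Rintegral_cst// mul0r.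
under eq_Rintegral do rewrite big_cons.
by rewrite big_cons -IHs bm_RintegralD//; exact: bm_sum.
Qed.

Lemma bm_le_Rintegral (P : probability T R) f g :
  bounded_measurable f -> bounded_measurable g ->
  (forall x, f x <= g x) -> \int[P]_x f x <= \int[P]_x g x.
Proof. by move=> *; apply: le_Rintegral => //; exact: bm_integrable. Qed.

Lemma Rintegral_probability_cst (P : probability T R) (r : R) :
  \int[P]_x r = r.
Proof.
rewrite Rintegral_cst// -[RHS]mulr1; congr (_ * _).
by rewrite -[RHS]/(fine 1%E); congr fine; exact: probability_setT.
Qed.

Lemma bm_normr_Rintegral_le (P : probability T R) f (M : R) :
  bounded_measurable f -> (forall x, `|f x| <= M) -> `|\int[P]_x f x| <= M.
Proof.
move=> bf fM; rewrite (le_trans (le_normr_Rintegral _ _))//.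
  exact: bm_integrable.
rewrite -[leRHS](Rintegral_probability_cst P); apply: bm_le_Rintegral => //.
  exact: bm_norm.
exact: bm_cst.
Qed.

Lemma bm_eq_Rintegral (P : probability T R) f g : f =1 g ->
  \int[P]_x f x = \int[P]_x g x.
Proof. by move=> fg; apply: eq_Rintegral => x _; exact: fg. Qed.

(** Multiplying [f] by the indicator of the complement of [N] changes it only on a null set and
    makes it nonnegative everywhere. *)
Lemma bm_Rintegral_ge0 (P : probability T R) f (N : set T) :
  bounded_measurable f -> measurable N -> P N = 0%E ->
  (forall x, ~ N x -> 0 <= f x) -> 0 <= \int[P]_x f x.
Proof.
move=> bf mN N0 f0.
have bg : bounded_measurable (fun x => f x * \1_(~` N) x).
  by apply: bmM => //; apply: bm_indic; exact: measurableC.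
rewrite (_ : \int[P]_x f x = \int[P]_x (f x * \1_(~` N) x)).
  apply: Rintegral_ge0 => x _; rewrite indicE.
  have [/set_mem /= /f0 ?|_] := boolP (x \in _); first by rewrite mulr1.
  by rewrite mulr0.
congr fine; apply: ae_eq_integral => //.
- by apply/measurable_EFinP; exact: bf.1.
- by apply/measurable_EFinP; exact: bg.1.
exists N; split=> // x /= nE; apply: contrapT => nN; apply: nE => _.
by rewrite indicE mem_set// mulr1.
Qed.

End bounded_measurable.

Lemma bm_comp {d1 d2 : measure_display} {T1 : measurableType d1}
    {T2 : measurableType d2} {R : realType} (f : T2 -> R) (h : T1 -> T2) :
  bounded_measurable f -> measurable_fun [set: T1] h ->
  bounded_measurable (fun x => f (h x)).
Proof.
move=> [mf [M fM]] mh; split; first exact: measurableT_comp.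
by exists M => x; exact: fM.
Qed.

(** * Fubini for bounded functions on a product of two probability spaces *)

Section bounded_fubini.
Context {d1 d2 : measure_display} {T1 : measurableType d1}
  {T2 : measurableType d2} {R : realType}.
Variables (P : probability T1 R) (Q : probability T2 R) (f : T1 * T2 -> R).
Hypothesis bf : bounded_measurable f.

Let intf : (P \x Q)%E.-integrable [set: T1 * T2] (EFin \o f).
Proof. exact: bm_integrable. Qed.

Lemma bm_section1 (x : T1) : bounded_measurable (fun y => f (x, y)).
Proof. by apply: bm_comp => //; exact: pair1_measurable. Qed.

Lemma bm_section2 (y : T2) : bounded_measurable (fun x => f (x, y)).
Proof. by apply: bm_comp => //; exact: pair2_measurable. Qed.

Lemma bm_fubini1 : bounded_measurable (fun x => \int[Q]_y f (x, y)).
Proof.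
have [M fM] := bf.2; split; last first.
  by exists M => x; apply: bm_normr_Rintegral_le => //; exact: bm_section1.
apply/measurable_EFinP.
rewrite (_ : _ \o _ = fubini_F Q (EFin \o f));
  first exact: measurable_fubini_F intf.
by apply/funext => x /=; rewrite bm_EFin_Rintegral//; exact: bm_section1.
Qed.

Lemma bm_fubini2 : bounded_measurable (fun y => \int[P]_x f (x, y)).
Proof.
have [M fM] := bf.2; split; last first.
  by exists M => x; apply: bm_normr_Rintegral_le => //; exact: bm_section2.
apply/measurable_EFinP.
rewrite (_ : _ \o _ = fubini_G P (EFin \o f));
  first exact: measurable_fubini_G intf.
by apply/funext => x /=; rewrite bm_EFin_Rintegral//; exact: bm_section2.
Qed.

Lemma bm_Rintegral_prod1 : \int[(P \x Q)%E]_z f z =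
  \int[P]_x \int[Q]_y f (x, y).
Proof.
congr fine; rewrite -(integral12_prod_meas1 intf); apply: eq_integral => x _.
by rewrite bm_EFin_Rintegral//; exact: bm_section1.
Qed.

Lemma bm_Rintegral_prod2 : \int[(P \x Q)%E]_z f z =
  \int[Q]_y \int[P]_x f (x, y).
Proof.
congr fine; rewrite -(integral21_prod_meas1 intf); apply: eq_integral => x _.
by rewrite bm_EFin_Rintegral//; exact: bm_section2.
Qed.

Lemma bm_fubini :
  \int[P]_x \int[Q]_y f (x, y) = \int[Q]_y \int[P]_x f (x, y).
Proof. by rewrite -bm_Rintegral_prod1 bm_Rintegral_prod2. Qed.

End bounded_fubini.


(** * The product probability on tuples and the resampling of a coordinate *)

Section tuple_probability.
Context {d : measure_display} {T : measurableType d}.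

Definition cons_pair {k : nat} (z : T * k.-tuple T) : k.+1.-tuple T :=
  [tuple of z.1 :: z.2].

Lemma measurable_cons_pair (k : nat) : measurable_fun [set: _] (@cons_pair k).
Proof. exact: measurable_cons. Qed.

HB.instance Definition _ (k : nat) :=
  isMeasurableFun.Build _ _ _ _ (@cons_pair k) (measurable_cons_pair k).

(** Not depending on coordinate [i] is expressed below as invariance under this update, which avoids
    cutting tuples into blocks of coordinates. *)
Definition set_tuple {k : nat} (t : k.-tuple T) (i : 'I_k) (y : T) :
  k.-tuple T := [tuple if j == i then y else tnth t j | j < k].

Lemma tnth_set_tuple (k : nat) (t : k.-tuple T) (i j : 'I_k) (y : T) :
  tnth (set_tuple t i y) j = if j == i then y else tnth t j.
Proof. by rewrite tnth_mktuple. Qed.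

Lemma set_tuple_cons0 (k : nat) (t : k.-tuple T) (x y : T) :
  set_tuple (cons_pair (x, t)) ord0 y = cons_pair (y, t).
Proof.
apply: eq_from_tnth => j; rewrite tnth_set_tuple.
have [j' ->|->] := unliftP ord0 j; rewrite ?eqxx//.
by rewrite eq_sym (negbTE (neq_lift _ _)) !tnthS.
Qed.

Lemma set_tuple_consS (k : nat) (t : k.-tuple T) (x y : T) (i : 'I_k) :
  set_tuple (cons_pair (x, t)) (lift ord0 i) y = cons_pair (x, set_tuple t i y).
Proof.
apply: eq_from_tnth => j; rewrite tnth_set_tuple.
have [j' ->|->] := unliftP ord0 j; last by rewrite (negbTE (neq_lift _ _)).
by rewrite (inj_eq lift_inj) !tnthS tnth_set_tuple.
Qed.

Lemma measurable_set_tuple (k : nat) (i : 'I_k) :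
  measurable_fun [set: k.-tuple T * T] (fun z => set_tuple z.1 i z.2).
Proof.
apply/measurable_fun_tnthP => j /=.
rewrite (_ : _ \o _ = fun z : k.-tuple T * T =>
    if j == i then z.2 else tnth z.1 j).
  case: (j == i); first exact: measurable_snd.
  apply: (measurableT_comp (f := fun t : k.-tuple T => tnth t j)) => //.
  exact: measurable_tnth.
by apply/funext => z /=; rewrite tnth_set_tuple.
Qed.

Lemma measurable_set_tuple_at (k : nat) (t : k.-tuple T) (i : 'I_k) :
  measurable_fun [set: T] (set_tuple t i).
Proof.
apply/measurable_fun_tnthP => j /=.
rewrite (_ : _ \o _ = fun y : T => if j == i then y else tnth t j).
  by case: (j == i); [exact: measurable_id|exact: measurable_cst].
by apply/funext => y /=; rewrite tnth_set_tuple.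
Qed.

Context {R : realType} (P : probability T R).

(** [tuple_pmeasure] is a bare set function. The iterated product is rebuilt here by pushforwards of
    binary products, so that it is a probability and can be integrated against. *)
Fixpoint tuple_probability (k : nat) : probability (k.-tuple T) R :=
  match k return probability (k.-tuple T) R with
  | 0 => \d_([tuple] : 0.-tuple T)
  | k'.+1 => distribution (P \x tuple_probability k')%E (@cons_pair k')
  end.

(** Unfolding the pushforward and the product leaves the integral of the measures of the sections;
    these are measurable, so the induction hypothesis applies to them. *)
Lemma tuple_probabilityE (k : nat) (A : set (k.-tuple T)) : measurable A ->
  tuple_pmeasure P A = tuple_probability k A.
Proof.
elim: k A => [|k IHk] A mA /=.
  rewrite diracE; have [At|nAt] := asboolP (A [tuple]); first by rewrite mem_set.
  by rewrite memNset.
rewrite /distribution /pushforward /= /product_measure1.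
apply: eq_integral => x _ /=.
have mcA : measurable (xsection (@cons_pair k @^-1` A) x).
  apply: measurable_xsection; rewrite -[X in measurable X]setTI.
  exact: measurable_cons_pair.
rewrite -IHk //; congr (tuple_pmeasure P _).
by apply/seteqP; split => t; rewrite /xsection /= inE.
Qed.

Lemma Rintegral_tuple_cons (k : nat) (f : k.+1.-tuple T -> R) :
  bounded_measurable f ->
  \int[tuple_probability k.+1]_t f t =
  \int[P]_x \int[tuple_probability k]_t f (cons_pair (x, t)).
Proof.
move=> bf.
have bfc : bounded_measurable (f \o @cons_pair k).
  by apply: bm_comp => //; exact: measurable_cons_pair.
rewrite -(bm_Rintegral_prod1 _ _ _ bfc); congr fine.
rewrite integral_distribution//; first by apply/measurable_EFinP; exact: bf.1.
exact: bm_integrable.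
Qed.

(** Coordinates are independent, so averaging over a fresh value of one of them preserves the
    integral. In the induction on [k], Fubini is used only at the first coordinate. *)
Lemma Rintegral_set_tuple (k : nat) (i : 'I_k) (f : k.-tuple T -> R) :
  bounded_measurable f ->
  \int[tuple_probability k]_t f t =
  \int[tuple_probability k]_t \int[P]_y f (set_tuple t i y).
Proof.
have bs n (j : 'I_n) (g : n.-tuple T -> R) : bounded_measurable g ->
    bounded_measurable (fun z : n.-tuple T * T => g (set_tuple z.1 j z.2)).
  by move=> bg; apply: (bm_comp g) => //; exact: measurable_set_tuple.
elim: k i f => [[]//|k IHk] i f bf.
have bfc : bounded_measurable (fun z => f (@cons_pair k z)).
  by apply: bm_comp => //; exact: measurable_cons_pair.
have bfs := bm_fubini1 (tuple_probability k.+1) P _ (bs _ i _ bf).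
rewrite Rintegral_tuple_cons// [RHS]Rintegral_tuple_cons//.
have [i' ->|->] := unliftP ord0 i.
  apply: bm_eq_Rintegral => x.
  rewrite (IHk i' (fun t => f (cons_pair (x, t)))); last exact: (bm_section1 _ bfc).
  by do 2 apply: bm_eq_Rintegral => ?; rewrite set_tuple_consS.
(* Resampling coordinate 0 erases the old value [x], so the outer integral is that of a constant. *)
transitivity (\int[P]_x \int[tuple_probability k]_t \int[P]_y
    f (cons_pair (y, t))); last first.
  by do 3 apply: bm_eq_Rintegral => ?; rewrite set_tuple_cons0.
rewrite [RHS]Rintegral_probability_cst.
exact: (bm_fubini _ _ _ bfc).
Qed.

End tuple_probability.


(** * Weights with values in the unit interval *)

Section unit_measurable.
Context {d : measure_display} {T : measurableType d} {R : realType}.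
Implicit Types f g : T -> R.

Definition unit_measurable f :=
  measurable_fun [set: T] f /\ forall x, 0 <= f x <= 1.

Lemma umW f : unit_measurable f -> bounded_measurable f.
Proof. by move=> [mf f01]; exact: bm_unit. Qed.

Lemma um1 : unit_measurable (fun=> 1).
Proof. by split; [exact: measurable_cst|move=> _; rewrite ler01 lexx]. Qed.

Lemma umM f g : unit_measurable f -> unit_measurable g ->
  unit_measurable (fun x => f x * g x).
Proof.
move=> [mf f01] [mg g01]; split; first exact: measurable_funM.
move=> x; have /andP[f0 f1] := f01 x; have /andP[g0 g1] := g01 x.
by rewrite mulr_ge0// mulr_ile1.
Qed.

Lemma um_prod (I : Type) (s : seq I) (F : I -> T -> R) :
  (forall i, unit_measurable (F i)) ->
  unit_measurable (fun x => \prod_(i <- s) F i x).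
Proof.
move=> uF; elim: s => [|i s IHs].
  by under eq_fun do rewrite big_nil; exact: um1.
by under eq_fun do rewrite big_cons; exact: umM.
Qed.

Lemma um_indic (A : set T) : measurable A -> unit_measurable (\1_A).
Proof.
move=> mA; split; first exact: measurable_indic.
by move=> x; rewrite indicE; case: (x \in A); rewrite ?lexx ler01.
Qed.

End unit_measurable.

Lemma um_comp {d1 d2 : measure_display} {T1 : measurableType d1}
    {T2 : measurableType d2} {R : realType} (f : T2 -> R) (h : T1 -> T2) :
  unit_measurable f -> measurable_fun [set: T1] h ->
  unit_measurable (fun x => f (h x)).
Proof. by move=> [mf f01] mh; split=> [|x//]; exact: measurableT_comp. Qed.

(** * The cut norm tested against weights instead of sets *)

Section cut_norm_bound.
Context {d : measure_display} {T : measurableType d} {R : realType}.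
Variable P : probability T R.

(* A linear functional on weights in [[0,1]] is extremal at an indicator. *)
Lemma Rintegral_weight_le (h u : T -> R) (C : R) :
  bounded_measurable h -> unit_measurable u ->
  (forall A, measurable A -> `|\int[P]_x (h x * \1_A x)| <= C) ->
  `|\int[P]_x (h x * u x)| <= C.
Proof.
move=> bh uu hC.
have mpos : measurable [set x | 0 <= h x].
  rewrite -[X in measurable X]setTI.
  have := measurable_fun_ler (measurable_cst (0 : R)) bh.1.
  by move=> /(_ measurableT [set true]); exact.
have mneg : measurable [set x | h x <= 0].
  rewrite -[X in measurable X]setTI.
  have := measurable_fun_ler bh.1 (measurable_cst (0 : R)).
  by move=> /(_ measurableT [set true]); exact.
have bhu : bounded_measurable (fun x => h x * u x) by apply: bmM => //; exact: umW.
have bhA A : measurable A -> bounded_measurable (fun x => h x * \1_A x).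
  by move=> mA; apply: bmM => //; exact: bm_indic.
(* As [0 <= u x <= 1], the product [h x * u x] lies between [h] restricted to [h <= 0] and [h]
   restricted to [0 <= h]. *)
rewrite ler_norml; apply/andP; split.
- apply: (@le_trans _ _ (\int[P]_x (h x * \1_[set x | h x <= 0] x))).
    by have /ler_normlP[] := hC _ mneg; rewrite lerNl.
  apply: bm_le_Rintegral => //; first exact: bhA.
  move=> x; have /andP[u0 u1] := uu.2 x; rewrite indicE.
  have [/set_mem /= h0|/negP] := boolP (x \in _); first by nra.
  by rewrite inE /= => /negP; rewrite -ltNge => h0; nra.
- apply: (@le_trans _ _ (\int[P]_x (h x * \1_[set x | 0 <= h x] x))); last first.
    by have /ler_normlP[] := hC _ mpos.
  apply: bm_le_Rintegral => //; first exact: bhA.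
  move=> x; have /andP[u0 u1] := uu.2 x; rewrite indicE.
  have [/set_mem /= h0|/negP] := boolP (x \in _); first by nra.
  by rewrite inE /= => /negP; rewrite -ltNge => h0; nra.
Qed.

(** The product of the two indicators is the indicator of a rectangle, so by Fubini this is one of
    the values in the supremum. *)
Lemma cut_norm_sets (V : T * T -> R) (C : R) (A B : set T) :
  bounded_measurable V -> (cut_norm P V <= C%:E)%E ->
  measurable A -> measurable B ->
  `|\int[P]_x \int[P]_y (V (x, y) * (\1_A x * \1_B y))| <= C.
Proof.
move=> bV VC mA mB.
have bVAB : bounded_measurable (fun z : T * T => V z * (\1_A z.1 * \1_B z.2)).
  apply: bmM => //; apply: bmM.
    by apply: (bm_comp (\1_A)) => //; exact: bm_indic.
  by apply: (bm_comp (\1_B)) => //; exact: bm_indic.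
rewrite -(bm_Rintegral_prod1 P P _ bVAB) -lee_fin EFin_normr_Rintegral//; last first.
  exact: bm_integrable.
apply: le_trans VC; apply: ereal_sup_ubound; exists A, B; split=> //.
congr (`| _ |)%E; rewrite [RHS]integral_mkcond; apply: eq_integral => -[x y] _.
rewrite patchE !indicE /=; have [/set_mem [/= Ax By]|nAB] := boolP ((x, y) \in _).
  by rewrite !mem_set// !mulr1.
have [xA|] := boolP (x \in A); last by rewrite mul0r mulr0.
have [yB|] := boolP (y \in B); last by rewrite !mulr0.
by move: nAB; rewrite mem_set//; split => /=; exact: set_mem.
Qed.

(** The integral is linear in each weight separately. Extremality at indicators is applied first to
    [f] with [g] fixed, then to [g] after exchanging the integrals; no constant is lost. *)
Lemma cut_norm_weights (V : T * T -> R) (C : R) (f g : T -> R) :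
  bounded_measurable V -> (cut_norm P V <= C%:E)%E ->
  unit_measurable f -> unit_measurable g ->
  `|\int[P]_x \int[P]_y (V (x, y) * (f x * g y))| <= C.
Proof.
move=> bV VC uf ug.
have bVw (a b : T -> R) : unit_measurable a -> unit_measurable b ->
    bounded_measurable (fun z : T * T => V z * (a z.1 * b z.2)).
  move=> /umW ba /umW bb; apply: bmM => //.
  by apply: bmM; [exact: (bm_comp a)|exact: (bm_comp b)].
have bVl (a : T -> R) : unit_measurable a ->
    bounded_measurable (fun z : T * T => V z * a z.1).
  by move=> /umW ba; apply: bmM => //; exact: (bm_comp a).
have bVr (a : T -> R) : unit_measurable a ->
    bounded_measurable (fun z : T * T => V z * a z.2).
  by move=> /umW ba; apply: bmM => //; exact: (bm_comp a).
have pullx (a b : T -> R) : unit_measurable a -> unit_measurable b ->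
    \int[P]_x \int[P]_y (V (x, y) * (a x * b y)) =
    \int[P]_x ((\int[P]_y (V (x, y) * b y)) * a x).
  move=> ua ub; apply: bm_eq_Rintegral => x.
  rewrite mulrC -bm_RintegralZl; last exact: (bm_section1 _ (bVr _ ub)).
  by apply: bm_eq_Rintegral => y; ring.
have pully (a b : T -> R) : unit_measurable a -> unit_measurable b ->
    \int[P]_x \int[P]_y (V (x, y) * (a x * b y)) =
    \int[P]_y ((\int[P]_x (V (x, y) * a x)) * b y).
  move=> ua ub; rewrite (bm_fubini P P _ (bVw _ _ ua ub)).
  apply: bm_eq_Rintegral => y.
  rewrite mulrC -bm_RintegralZl; last exact: (bm_section2 _ (bVl _ ua)).
  by apply: bm_eq_Rintegral => x /=; ring.
rewrite pullx//; apply: Rintegral_weight_le => //.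
  exact: (bm_fubini1 P P _ (bVr _ ug)).
move=> A mA; have uA : unit_measurable (\1_A : T -> R) by exact: um_indic.
rewrite -pullx// pully//; apply: Rintegral_weight_le => //.
  exact: (bm_fubini2 P P _ (bVl _ uA)).
move=> B mB; rewrite -pully//; last exact: um_indic.
exact: cut_norm_sets.
Qed.

End cut_norm_bound.


(** * The counting lemma *)

Section counting.
Context {d : measure_display} {T : measurableType d} {R : realType} {k : nat}.
Implicit Types (i j : 'I_k) (h u : k.-tuple T -> R) (e : 'I_k * 'I_k).

(** [a] ignores coordinate [j] and [b] ignores coordinate [i]: with the other coordinates frozen,
    [h] is a weight in [x_i] times a weight in [x_j], the form that the cut norm controls. *)
Definition splits i j h := exists a b : k.-tuple T -> R,
  [/\ unit_measurable a, unit_measurable b,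
      (forall t y, a (set_tuple t j y) = a t),
      (forall t y, b (set_tuple t i y) = b t) &
      forall t, h t = a t * b t].

Lemma splits_um i j h : splits i j h -> unit_measurable h.
Proof.
move=> [a [b [ua ub _ _ hab]]].
by rewrite (_ : h = fun t => a t * b t); [exact: umM|exact/funext].
Qed.

Lemma splits1 i j : splits i j (fun=> 1).
Proof.
exists (fun=> 1), (fun=> 1); split=> //; try exact: um1.
by move=> _; rewrite mulr1.
Qed.

Lemma splitsM i j h1 h2 : splits i j h1 -> splits i j h2 ->
  splits i j (fun t => h1 t * h2 t).
Proof.
move=> [a1 [b1 [ua1 ub1 a1j b1i h1E]]] [a2 [b2 [ua2 ub2 a2j b2i h2E]]].
exists (fun t => a1 t * a2 t), (fun t => b1 t * b2 t); split.
- exact: umM.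
- exact: umM.
- by move=> t y; rewrite a1j a2j.
- by move=> t y; rewrite b1i b2i.
- by move=> t; rewrite h1E h2E mulrACA.
Qed.

Lemma splits_prod i j (I : eqType) (s : seq I) (F : I -> k.-tuple T -> R) :
  (forall x, x \in s -> splits i j (F x)) ->
  splits i j (fun t => \prod_(x <- s) F x t).
Proof.
elim: s => [|x s IHs] sF.
  by under eq_fun do rewrite big_nil; exact: splits1.
under eq_fun do rewrite big_cons; apply: splitsM.
  by apply: sF; rewrite mem_head.
by apply: IHs => y ys; apply: sF; rewrite in_cons ys orbT.
Qed.

Lemma um_tnth (v : T -> R) i : unit_measurable v ->
  unit_measurable (fun t : k.-tuple T => v (tnth t i)).
Proof. by move=> uv; apply: (um_comp v) => //; exact: measurable_tnth. Qed.

Lemma splits_tnth i j (v : T -> R) l : i != j -> unit_measurable v ->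
  splits i j (fun t => v (tnth t l)).
Proof.
move=> ij uv; have [lj|lj] := eqVneq l j.
- exists (fun=> 1), (fun t => v (tnth t l)); split=> //.
  + exact: um1.
  + exact: um_tnth.
  + by move=> t y; rewrite tnth_set_tuple lj eq_sym (negbTE ij).
  + by move=> t; rewrite mul1r.
- exists (fun t => v (tnth t l)), (fun=> 1); split=> //.
  + exact: um_tnth.
  + exact: um1.
  + by move=> t y; rewrite tnth_set_tuple (negbTE lj).
  + by move=> t; rewrite mulr1.
Qed.

Definition edge_val (X : T * T -> R) e (t : k.-tuple T) :=
  X (tnth t e.1, tnth t e.2).

Lemma measurable_edge e :
  measurable_fun [set: k.-tuple T] (fun t => (tnth t e.1, tnth t e.2)).
Proof. by apply: measurable_fun_pair; exact: measurable_tnth. Qed.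

Lemma bm_edge_val X e : bounded_measurable X ->
  bounded_measurable (edge_val X e).
Proof. by move=> bX; apply: (bm_comp X) => //; exact: measurable_edge. Qed.

Lemma um_edge_val X e : unit_measurable X -> unit_measurable (edge_val X e).
Proof. by move=> uX; apply: (um_comp X) => //; exact: measurable_edge. Qed.

(** Both pairs are increasing, so an edge other than [(i, j)] cannot contain both [i] and [j]. It
    goes to the second factor if it meets [j] and to the first otherwise. *)
Lemma splits_edge_val X i j e : unit_measurable X ->
  (i < j)%N -> (e.1 < e.2)%N -> e != (i, j) -> splits i j (edge_val X e).
Proof.
case: e => p q uX ij pq neq /=.
have [pj|pj] := eqVneq p j; [|have [qj|qj] := eqVneq q j].
- exists (fun=> 1), (edge_val X (p, q)); split=> //.
  + exact: um1.
  + exact: um_edge_val.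
  + move=> t y; rewrite /edge_val !tnth_set_tuple /=.
    rewrite pj in pq *; rewrite -!val_eqE /= (gtn_eqF ij).
    by rewrite (gtn_eqF (ltn_trans ij pq)).
  + by move=> t; rewrite mul1r.
- exists (fun=> 1), (edge_val X (p, q)); split=> //.
  + exact: um1.
  + exact: um_edge_val.
  + move=> t y; rewrite /edge_val !tnth_set_tuple /=.
    move: neq; rewrite qj xpair_eqE eqxx andbT => /negbTE ->.
    by rewrite -val_eqE /= (gtn_eqF ij).
  + by move=> t; rewrite mul1r.
- exists (edge_val X (p, q)), (fun=> 1); split=> //.
  + exact: um_edge_val.
  + exact: um1.
  + by move=> t y; rewrite /edge_val !tnth_set_tuple /= (negbTE pj) (negbTE qj).
  + by move=> t; rewrite mulr1.
Qed.

Variable P : probability T R.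
Local Notation Pk := (tuple_probability P k).

(* Resampling the coordinates [i] and [j] reduces the claim, for each fixed
   value of the other coordinates, to a two-variable integral with weights. *)
Lemma edge_le_cut_norm (V : T * T -> R) (C : R) i j h :
  bounded_measurable V -> (cut_norm P V <= C%:E)%E -> i != j ->
  splits i j h -> `|\int[Pk]_t (edge_val V (i, j) t * h t)| <= C.
Proof.
move=> bV VC ij sh; have uh := splits_um _ _ _ sh.
have [a [b [ua ub aj bi hab]]] := sh.
have bF : bounded_measurable (fun t => edge_val V (i, j) t * h t).
  by apply: bmM; [exact: bm_edge_val|exact: umW].
have bset l (g : k.-tuple T -> R) : bounded_measurable g ->
    bounded_measurable (fun t => \int[P]_y g (set_tuple t l y)).
  move=> bg; have bgs : bounded_measurable
      (fun z : k.-tuple T * T => g (set_tuple z.1 l z.2)).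
    by apply: (bm_comp g) => //; exact: measurable_set_tuple.
  exact: (bm_fubini1 Pk P _ bgs).
have bG := bset j _ bF.
rewrite (Rintegral_set_tuple P k j)// (Rintegral_set_tuple P k i _ bG).
apply: bm_normr_Rintegral_le; first exact: (bset i _ bG).
move=> t; rewrite (_ : \int[P]_y _ = \int[P]_y \int[P]_z
    (V (y, z) * (a (set_tuple t i y) * b (set_tuple t j z)))).
  apply: cut_norm_weights => //.
    apply: (um_comp a) => //.
    exact: measurable_set_tuple_at.
  apply: (um_comp b) => //.
  exact: measurable_set_tuple_at.
apply: bm_eq_Rintegral => y; apply: bm_eq_Rintegral => z.
have -> : edge_val V (i, j) (set_tuple (set_tuple t i y) j z) = V (y, z).
  by rewrite /edge_val /= !tnth_set_tuple !eqxx (negbTE ij).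
congr (_ * _); rewrite hab aj; congr (_ * _).
(* The update at [i] sits below the one at [j]; as [i] and [j] differ the two commute, and then [b]
   ignores the one at [i]. *)
rewrite -[RHS](bi _ y); congr b; apply: eq_from_tnth => l.
rewrite !tnth_set_tuple; have [->|lj] := eqVneq l j => //.
by rewrite eq_sym (negbTE ij).
Qed.

(* Telescoping: the edges in [s] are switched from [X] to [Y] one at a time. *)
Lemma counting_lemma_seq (X Y : T * T -> R) (C : R) (s r : seq ('I_k * 'I_k)) u :
  unit_measurable X -> unit_measurable Y ->
  (cut_norm P (fun z => X z - Y z)%R <= C%:E)%E ->
  uniq (s ++ r) -> all (fun e => e.1 < e.2)%N (s ++ r) ->
  unit_measurable u -> (forall i j, (i < j)%N -> splits i j u) ->
  `|\int[Pk]_t (\prod_(e <- s) edge_val X e t * \prod_(e <- r) edge_val Y e t * u t)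
    - \int[Pk]_t (\prod_(e <- s ++ r) edge_val Y e t * u t)| <= C *+ size s.
Proof.
move=> uX uY XYC; elim: s r => [|[i j] s IHs] r + + uu su.
  move=> _ _; rewrite /= mulr0n normr_le0 subr_eq0; apply/eqP.
  by apply: bm_eq_Rintegral => t; rewrite big_nil mul1r.
rewrite cat_cons cons_uniq => /andP[eN us] /= /andP[ij als].
have bprod (Z : T * T -> R) (s' : seq _) : unit_measurable Z ->
    unit_measurable (fun t => \prod_(e <- s') edge_val Z e t).
  by move=> uZ; apply: um_prod => e; exact: um_edge_val.
(* [s] holds the edges still carrying [X] and [r] those already carrying [Y]; [w] is the common
   factor of the two integrands that differ in the edge [(i, j)]. *)
pose w t := \prod_(e <- s) edge_val X e t * \prod_(e <- r) edge_val Y e t * u t.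
have uw : unit_measurable w by do 2 apply: umM => //; exact: bprod.
have sw : splits i j w.
  apply: splitsM; last exact: su.
  apply: splitsM; apply: splits_prod => e es; apply: splits_edge_val => //.
  - by apply: (allP als); rewrite mem_cat es.
  - by apply: contraNneq eN => <-; rewrite mem_cat es.
  - by apply: (allP als); rewrite mem_cat es orbT.
  - by apply: contraNneq eN => <-; rewrite mem_cat es orbT.
have bw (Z : T * T -> R) : unit_measurable Z ->
    bounded_measurable (fun t => edge_val Z (i, j) t * w t).
  by move=> uZ; apply/umW/umM => //; exact: um_edge_val.
(* Once switched, [(i, j)] joins [r], so the induction hypothesis concerns a permuted edge list. *)
have permE : perm_eq (s ++ (i, j) :: r) ((i, j) :: s ++ r).
  by rewrite perm_catC cat_cons perm_cons perm_catC.
have := IHs ((i, j) :: r); rewrite (perm_uniq permE) (perm_all _ permE) /=.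
rewrite eN us ij als => /(_ isT isT uu su) IH.
rewrite mulrS.
rewrite (_ : \int[Pk]_t (_ * u t) = \int[Pk]_t (edge_val X (i, j) t * w t)); last first.
  by apply: bm_eq_Rintegral => t; rewrite big_cons /w; ring.
rewrite (_ : \int[Pk]_t (_ * u t) = \int[Pk]_t (edge_val Y (i, j) t * w t)) in IH; last first.
  by apply: bm_eq_Rintegral => t; rewrite big_cons /w; ring.
rewrite (_ : \int[Pk]_t (\prod_(e <- s ++ (i, j) :: r) edge_val Y e t * u t) =
    \int[Pk]_t (\prod_(e <- (i, j) :: s ++ r) edge_val Y e t * u t)) in IH; last first.
  by apply: bm_eq_Rintegral => t; rewrite (perm_big _ permE).
(* Here [b] arises from [a] by switching [(i, j)], and [c] has every edge switched. In
   [(a - b) + (b - c)] the first term costs one cut-norm bound and the second is the induction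
   hypothesis. *)
set c := (X in _ - X) in IH *; set b := (X in X - c) in IH; set a := (X in X - c).
rewrite -(subrK b a) -addrA (le_trans (ler_normD _ _))// lerD//.
rewrite /a /b -bm_RintegralB; [|exact: bw|exact: bw].
under bm_eq_Rintegral do rewrite -mulrBl.
apply: (edge_le_cut_norm _ _ _ _ _ _ XYC _ sw).
  by apply: bmB; exact: umW.
by rewrite -val_eqE /= ltn_eqF.
Qed.

End counting.


(** * Densities, marginals and the cover inequality in the limit *)

Section hom_density.
Context {d : measure_display} {T : measurableType d} {R : realType} {k : nat}.
Variables (P : probability T R) (F : rel 'I_k).
Implicit Types (X Y W : T * T -> R) (c : T -> R) (i j : 'I_k).
Local Notation Pk := (tuple_probability P k).

(** The double product is flattened to a duplicate-free list of increasing pairs, on which the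
    telescoping can run. *)
Definition edges : seq ('I_k * 'I_k) :=
  [seq e : 'I_k * 'I_k <- index_enum _ | (e.1 < e.2)%N && F e.1 e.2].

Lemma hom_density_funE X t :
  hom_density_fun F X t = \prod_(e <- edges) edge_val X e t.
Proof. by rewrite /hom_density_fun pair_big_dep /= big_filter. Qed.

Lemma um_hom_density X : unit_measurable X ->
  unit_measurable (hom_density_fun F X).
Proof.
move=> uX; rewrite (_ : hom_density_fun F X =
    fun t => \prod_(e <- edges) edge_val X e t).
  by apply: um_prod => e; exact: um_edge_val.
by apply/funext => t; exact: hom_density_funE.
Qed.

(** The telescoping starts with every edge on [X] and none switched. The weight has to split along
    each increasing pair, since any of them may be an edge. *)
Lemma counting_lemma X Y (C : R) (u : k.-tuple T -> R) :
  unit_measurable X -> unit_measurable Y ->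
  (cut_norm P (fun z => X z - Y z)%R <= C%:E)%E ->
  unit_measurable u -> (forall i j, (i < j)%N -> splits i j u) ->
  `|\int[Pk]_t (hom_density_fun F X t * u t)
    - \int[Pk]_t (hom_density_fun F Y t * u t)| <= C *+ size edges.
Proof.
move=> uX uY XYC uu su.
have := counting_lemma_seq P _ _ _ edges [::] u uX uY XYC.
rewrite cats0 filter_uniq ?index_enum_uniq// => /(_ isT).
have -> : all (fun e : 'I_k * 'I_k => e.1 < e.2)%N edges.
  by apply/allP => e; rewrite mem_filter => /andP[/andP[]].
move=> /(_ isT uu su); congr (`| _ - _ | <= _); apply: bm_eq_Rintegral => t.
  by rewrite big_nil mulr1 hom_density_funE.
by rewrite hom_density_funE.
Qed.

(** Kept as a product of functions of one coordinate, the form that splits along every pair. *)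
Definition box_indic (A : 'I_k -> set T) (t : k.-tuple T) : R :=
  \prod_(l < k) \1_(A l) (tnth t l).

Lemma box_indic1 (A : 'I_k -> set T) t :
  (forall l, A l (tnth t l)) -> box_indic A t = 1.
Proof. by move=> At; apply: big1 => l _; rewrite indicE mem_set. Qed.

Lemma box_indic0 (A : 'I_k -> set T) t :
  ~ (forall l, A l (tnth t l)) -> box_indic A t = 0.
Proof.
move=> /existsNP[l Al]; rewrite /box_indic (bigD1 l)//= indicE memNset//.
by rewrite mul0r.
Qed.

Lemma splits_box_indic (A : 'I_k -> set T) (i j : 'I_k) :
  (forall l, measurable (A l)) -> (i < j)%N -> splits i j (box_indic A).
Proof.
move=> mA ij; apply: splits_prod => l _; apply: (splits_tnth _ _ (\1_(A l))).
  by rewrite -val_eqE /= ltn_eqF.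
exact: um_indic.
Qed.

Lemma um_box_indic (A : 'I_k -> set T) :
  (forall l, measurable (A l)) -> unit_measurable (box_indic A).
Proof.
move=> mA; apply: um_prod => l; apply: (um_tnth (\1_(A l))).
exact: um_indic.
Qed.

Lemma bm_sum_tnth c : bounded_measurable c ->
  bounded_measurable (fun t : k.-tuple T => \sum_(l < k) c (tnth t l)).
Proof.
move=> bc; apply: bm_sum => l.
by apply: (bm_comp c) => //; exact: measurable_tnth.
Qed.

Lemma measurable_uncovered X c : unit_measurable X -> unit_measurable c ->
  measurable (hom_support F X `&`
              [set t | \sum_(i < k) c (tnth t i) < 1]).
Proof.
move=> uX uc; apply: measurableI.
  have [mH _] := um_hom_density _ uX.
  rewrite (_ : hom_support F X = ~` (hom_density_fun F X @^-1` [set 0])).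
    by apply: measurableC; rewrite -[X in measurable X]setTI; exact: mH.
  by apply/seteqP; split=> t /= /eqP.
rewrite -[X in measurable X]setTI.
have := measurable_fun_ltr (bm_sum_tnth _ (umW _ uc)).1 (measurable_cst (1 : R)).
by move=> /(_ measurableT [set true]); exact.
Qed.

Lemma frac_cover_null X c : unit_measurable X -> frac_cover P F X c ->
  Pk (hom_support F X `&` [set t | \sum_(i < k) c (tnth t i) < 1]) = 0%E.
Proof.
move=> uX [mc c01 c0]; rewrite -tuple_probabilityE//.
by apply: measurable_uncovered.
Qed.

(** All [k] coordinates are integrated, but the value at [l] is overwritten by [y]; since the total
    mass is one, this is the usual marginal. *)
Definition marginal (h : k.-tuple T -> R) (l : 'I_k) (y : T) : R :=
  \int[Pk]_t h (set_tuple t l y).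

Lemma bm_marginal h l : bounded_measurable h -> bounded_measurable (marginal h l).
Proof.
move=> bh; have bhs : bounded_measurable
    (fun z : k.-tuple T * T => h (set_tuple z.1 l z.2)).
  by apply: (bm_comp h) => //; exact: measurable_set_tuple.
exact: (bm_fubini2 Pk P _ bhs).
Qed.

(** Resampling coordinate [l] and exchanging the integrals turns [c] into a factor of a one-variable
    integral. The other factor does not involve [c], so it can serve as a fixed weak* test
    function. *)
Lemma Rintegral_marginal h l c : bounded_measurable h -> bounded_measurable c ->
  \int[Pk]_t (h t * c (tnth t l)) = \int[P]_y (c y * marginal h l y).
Proof.
move=> bh bc.
have bhc : bounded_measurable (fun t => h t * c (tnth t l)).
  by apply: bmM => //; apply: (bm_comp c) => //; exact: measurable_tnth.
have bhs : bounded_measurable (fun z : k.-tuple T * T => h (set_tuple z.1 l z.2)).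
  by apply: (bm_comp h) => //; exact: measurable_set_tuple.
have bhcs : bounded_measurable
    (fun z : k.-tuple T * T => h (set_tuple z.1 l z.2) * c z.2).
  by apply: bmM => //; exact: (bm_comp c).
rewrite (Rintegral_set_tuple P k l _ bhc).
transitivity (\int[Pk]_t \int[P]_y (h (set_tuple t l y) * c y)).
  by do 2 apply: bm_eq_Rintegral => ?; rewrite tnth_set_tuple eqxx.
rewrite (bm_fubini Pk P _ bhcs); apply: bm_eq_Rintegral => y.
rewrite -bm_RintegralZl; last exact: (bm_section2 _ bhs).
by apply: bm_eq_Rintegral => t; rewrite mulrC.
Qed.

Lemma Rintegral_cover_defect h c : bounded_measurable h -> bounded_measurable c ->
  \int[Pk]_t (h t * (\sum_(l < k) c (tnth t l) - 1)) =
  \sum_(l < k) \int[Pk]_t (h t * c (tnth t l)) - \int[Pk]_t h t.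
Proof.
move=> bh bc.
have bhc l : bounded_measurable (fun t => h t * c (tnth t l)).
  by apply: bmM => //; apply: (bm_comp c) => //; exact: measurable_tnth.
rewrite -bm_Rintegral_sum// -bm_RintegralB//; last exact: bm_sum.
by apply: bm_eq_Rintegral => t; rewrite mulrBr mulr1 mulr_sumr.
Qed.

(* Testing the cover inequality of [W_n] against [W_n^F 1_A >= 0] and passing
   to the limit: [W_n^F] converges against product weights, one of them being
   [c_n], while [c_n] converges against the fixed marginals of [W^F 1_A]. *)
Lemma cover_defect_ge0 (Ws : nat -> T * T -> R) W (cs : nat -> T -> R) c
    (A : 'I_k -> set T) :
  (forall n, unit_measurable (Ws n)) -> unit_measurable W ->
  (fun n => cut_norm P (fun z => Ws n z - W z)) @ \oo --> 0%E ->
  (forall n, frac_cover P F (Ws n) (cs n)) -> unit_measurable c ->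
  weakstar_accumulation P cs c -> (forall l, measurable (A l)) ->
  0 <= \int[Pk]_t (hom_density_fun F W t * box_indic A t *
                   (\sum_(l < k) c (tnth t l) - 1)).
Proof.
move=> uWs uW cutW covs uc wc mA.
have ucs n : unit_measurable (cs n) by have [mc c01 _] := covs n.
pose h X t := hom_density_fun F X t * box_indic A t.
have uh X : unit_measurable X -> unit_measurable (h X).
  by move=> uX; apply: umM; [exact: um_hom_density|exact: um_box_indic].
pose m := size edges.
apply/ler_addgt0Pr => e e0.
(* Error budget in units of [dl]: each of the [k] coordinates costs [m] for changing the graphon and
   1 for changing the cover, and the term without cover costs another [m]. Dividing by [K + 1] is
   safe even when [K = 0]. *)
pose K : R := k%:R * (1 + m%:R) + m%:R.
have K0 : 0 <= K by rewrite addr_ge0// mulr_ge0// addr_ge0// ler0n.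
pose dl := e / (K + 1).
have dl0 : 0 < dl by rewrite divr_gt0// ltr_wpDl.
have KE : K * dl <= e.
  rewrite /dl mulrCA ger_pMr// ler_pdivrMr ?ltr_wpDl// mul1r.
  by rewrite lerDl.
have [N _ cutN] : \forall n \near \oo,
    (cut_norm P (fun z => Ws n z - W z)%R <= dl%:E)%E.
  have /fine_cvgP[finW /cvgr0Pnorm_le/(_ _ dl0) leW] := cutW.
  near=> n; have finn : cut_norm P (fun z => Ws n z - W z) \is a fin_num.
    by near: n.
  rewrite -(fineK finn) lee_fin; apply: le_trans (ler_norm _) _.
  by near: n.
(* A single index beyond [N] serves all [k] marginals at once, since a weak* neighbourhood admits
   finitely many test functions. *)
have [n Nn wcn] := wc k (marginal (h W)) dl
  (fun l => bm_integrable P _ (bm_marginal _ l (umW _ (uh _ uW)))) dl0 N.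
have {}cutN := cutN n Nn.
pose B X v l := \int[Pk]_t (h X t * v (tnth t l)).
(* The weight involves [cs n] and thus moves with [n], but the counting lemma is uniform over
   weights. *)
have B1 l : `|B (Ws n) (cs n) l - B W (cs n) l| <= dl *+ m.
  rewrite /B /h.
  under bm_eq_Rintegral do rewrite -mulrA.
  under [X in _ - X]bm_eq_Rintegral do rewrite -mulrA.
  apply: counting_lemma => //.
    by apply: umM; [exact: um_box_indic|exact: um_tnth].
  move=> i j ij; apply: splitsM; first exact: splits_box_indic.
  by apply: splits_tnth => //; rewrite -val_eqE /= ltn_eqF.
have B2 l : `|B W (cs n) l - B W c l| <= dl.
  have bg := bm_marginal _ l (umW _ (uh _ uW)).
  have bhW := umW _ (uh _ uW); have bcn := umW _ (ucs n); have bc := umW _ uc.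
  rewrite /B (Rintegral_marginal _ l _ bhW bcn) (Rintegral_marginal _ l _ bhW bc).
  have bcng := bmM _ _ bcn bg; have bcg := bmM _ _ bc bg.
  rewrite -(bm_RintegralB P _ _ bcng bcg) -lee_fin.
  rewrite (EFin_normr_Rintegral _ (bm_integrable P _ (bmB _ _ bcng bcg)))//.
  apply/ltW; apply: le_lt_trans (wcn l).
  by under eq_integral do rewrite -mulrBl.
have B3 : `|\int[Pk]_t h (Ws n) t - \int[Pk]_t h W t| <= dl *+ m.
  apply: counting_lemma => //; first exact: um_box_indic.
  by move=> i j ij; exact: splits_box_indic.
(* Off the null set of uncovered tuples, either the density vanishes or the covering sum is at least
   1. *)
have Dn0 : 0 <= \int[Pk]_t (h (Ws n) t * (\sum_(l < k) cs n (tnth t l) - 1)).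
  apply: (bm_Rintegral_ge0 _ _ _ _ (measurable_uncovered _ _ (uWs n) (ucs n))).
  - apply: bmM; first exact/umW/uh.
    by apply: bmB; [exact/bm_sum_tnth/umW|exact: bm_cst].
  - exact: frac_cover_null.
  - move=> t /= nt; have /andP[bx0 _] := (um_box_indic _ mA).2 t.
    have /andP[hd0 _] := (um_hom_density _ (uWs n)).2 t.
    have [hd|hd] := eqVneq (hom_density_fun F (Ws n) t) 0.
      by rewrite /h hd !mul0r.
    rewrite mulr_ge0//; first exact: mulr_ge0.
    rewrite subr_ge0 leNgt; apply/negP => clt; exact: nt.
rewrite Rintegral_cover_defect in Dn0; [|exact/umW/uh|exact: umW].
rewrite (Rintegral_cover_defect (h W)); [|exact/umW/uh|exact: umW].
(* Only one-sided bounds are needed from here: the defect for [W] and [c] is at least the one for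
   [Ws n] and [cs n] minus [K * dl], hence at least [- e]. *)
have sumB : \sum_(l < k) B (Ws n) (cs n) l - \sum_(l < k) B W c l <=
    (dl + dl *+ m) *+ k.
  rewrite -sumrB -[X in _ *+ X]card_ord -sumr_const; apply: ler_sum => l _.
  rewrite -(subrK (B W (cs n) l) (B (Ws n) (cs n) l)) -addrA addrC lerD//.
    exact: le_trans (ler_norm _) (B2 l).
  exact: le_trans (ler_norm _) (B1 l).
have B3' : - (dl *+ m) <= \int[Pk]_t h (Ws n) t - \int[Pk]_t h W t.
  by have /ler_normlP[+ _] := B3; rewrite lerNl.
have Ke : (dl + dl *+ m) *+ k + dl *+ m = K * dl.
  by rewrite /K -(mulr_natr dl m) -(mulr_natr _ k); ring.
rewrite /B in sumB.
lra.
Unshelve. all: by end_near.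
Qed.

End hom_density.


(** * Weak* accumulation points: bounds and change of representative *)

Section weakstar.
Context {d : measure_display} {T : measurableType d} {R : realType}.
Variable P : probability T R.

Lemma measurable_gt0 (h : T -> R) : measurable_fun [set: T] h ->
  measurable [set x | 0 < h x].
Proof.
move=> mh; rewrite -[X in measurable X]setTI.
have := measurable_fun_ltr (measurable_cst (0 : R)) mh.
by move=> /(_ measurableT [set true]); exact.
Qed.

(** The integrand is the positive part of [h]; its integral is below every [e], hence zero, so it
    vanishes almost everywhere. *)
Lemma ae_le0 (h : T -> R) : measurable_fun [set: T] h ->
  (forall e : R, 0 < e ->
    (\int[P]_x (h x * \1_[set y | 0 < h y] x)%:E <= e%:E)%E) ->
  {ae P, forall x, h x <= 0}.
Proof.
move=> mh he; set f := fun x => h x * \1_[set y | 0 < h y] x.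
have f0 x : 0 <= f x.
  rewrite /f indicE; have [/set_mem /= /ltW h0|_] := boolP (x \in _).
    by rewrite mulr1.
  by rewrite mulr0.
have mf : measurable_fun [set: T] (EFin \o f).
  apply/measurable_EFinP; apply: measurable_funM => //.
  exact/measurable_indic/measurable_gt0.
have intf0 : (\int[P]_x `|(EFin \o f) x| = 0)%E.
  apply/eqP; rewrite eq_le integral_ge0 ?andbT//.
  apply/lee_addgt0Pr => e e0; rewrite add0e; apply: le_trans (he e e0).
  by under eq_integral do rewrite /= ger0_norm ?f0//.
have [N [mN N0 fN]] := (ae_eq_integral_abs P measurableT mf).1 intf0.
exists N; split=> // x /= hx; apply: fN => /= /(_ Logic.I) [].
have {}hx : 0 < h x by rewrite ltNge; exact/negP.
by rewrite /f indicE mem_set// mulr1 => h0; move: hx; rewrite h0 ltxx.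
Qed.

(** The indicators of [c < 0] and [c > 1] are used as test functions: there [cs n] is on the right
    side of the bound, so [cs n - c] dominates the violation in absolute value. As [c] is only
    measurable, nonnegative integrals are compared and never subtracted. *)
Lemma weakstar_accumulation_unit (cs : nat -> T -> R) (c : T -> R) :
  (forall n, unit_measurable (cs n)) -> measurable_fun [set: T] c ->
  weakstar_accumulation P cs c -> {ae P, forall x, 0 <= c x <= 1}.
Proof.
move=> ucs mc wc.
have test (A : set T) e : measurable A -> 0 < e ->
    exists n, (`| \int[P]_x ((cs n x - c x) * \1_A x)%:E | < e%:E)%E.
  move=> mA e0.
  have [|n _ wn] := wc 1%N (fun=> \1_A) e _ e0 0%N.
    by move=> _; apply: bm_integrable; exact: bm_indic.
  by exists n; exact: (wn ord0).
have mN : measurable_fun [set: T] (fun x => - c x) by exact: measurableT_comp.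
have mB : measurable_fun [set: T] (fun x => c x - 1) by exact: measurable_funB.
have mfI (g : T -> R) (A : set T) : measurable_fun [set: T] g -> measurable A ->
    measurable_fun [set: T] (fun x => (g x * \1_A x)%:E).
  by move=> mg mA; apply/measurable_EFinP/measurable_funM => //; exact: measurable_indic.
have c_ge0 : {ae P, forall x, - c x <= 0}.
  apply: ae_le0 => // e e0.
  have mA := measurable_gt0 _ mN.
  have [n /ltW cn] := test _ _ mA e0.
  apply: le_trans cn; apply: le_trans (lee_abs _).
  have cs0 x : 0 <= cs n x by have /andP[] := (ucs n).2 x.
  apply: ge0_le_integral => //.
  - move=> x _; rewrite lee_fin indicE.
    have [/set_mem /= /ltW h0|_] := boolP (x \in _); first by rewrite mulr1.
    by rewrite mulr0.
  - exact: mfI.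
  - by apply: mfI => //; apply: measurable_funB => //; exact: (ucs n).1.
  - by move=> x _; rewrite lee_fin ler_wpM2r// lerBrDr addNr.
have c_le1 : {ae P, forall x, c x - 1 <= 0}.
  apply: ae_le0 => // e e0.
  have mA := measurable_gt0 _ mB.
  have [n /ltW cn] := test _ _ mA e0.
  have cs1 x : cs n x <= 1 by have /andP[] := (ucs n).2 x.
  have g0 x : (0 <= ((c x - cs n x) * \1_[set y | 0 < c y - 1] x)%:E)%E.
    rewrite lee_fin indicE; have [/set_mem /= h0|_] := boolP (x \in _).
      by rewrite mulr1; have := cs1 x; lra.
    by rewrite mulr0.
  (* Where [c > 1] it is [c - cs n] that is nonnegative, so the sign of the tested integral is
     reversed. *)
  have cn' : (`| \int[P]_x ((c x - cs n x) * \1_[set y | 0 < c y - 1]%R x)%:E |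
      <= e%:E)%E.
    rewrite -abseN -integral_ge0N//; apply: le_trans cn.
    by under eq_integral do rewrite -EFinN -mulNr opprB.
  apply: le_trans cn'; apply: le_trans (lee_abs _).
  apply: ge0_le_integral => //.
  - move=> x _; rewrite lee_fin indicE.
    have [/set_mem /= /ltW h0|_] := boolP (x \in _); first by rewrite mulr1.
    by rewrite mulr0.
  - exact: mfI.
  - by apply: mfI => //; apply: measurable_funB => //; exact: (ucs n).1.
  - by move=> x _; rewrite lee_fin ler_wpM2r// lerD2l lerN2.
apply: filterS2 c_ge0 c_le1 => x.
by rewrite oppr_le0 subr_le0 => -> ->.
Qed.

Lemma weakstar_accumulation_ae (cs : nat -> T -> R) (c c' : T -> R) :
  (forall n, measurable_fun [set: T] (cs n)) ->
  measurable_fun [set: T] c -> measurable_fun [set: T] c' ->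
  {ae P, forall x, c' x = c x} ->
  weakstar_accumulation P cs c -> weakstar_accumulation P cs c'.
Proof.
move=> mcs mc mc' cc' wc m g e ig e0 N.
have [n Nn wn] := wc m g e ig e0 N; exists n => // i.
have mg : measurable_fun [set: T] (g i).
  by apply/measurable_EFinP; exact: measurable_int (ig i).
have mfg (v : T -> R) : measurable_fun [set: T] v ->
    measurable_fun [set: T] (fun x => ((cs n x - v x) * g i x)%:E).
  move=> mv; apply/measurable_EFinP/measurable_funM => //.
  exact: measurable_funB.
apply: le_lt_trans (wn i); rewrite le_eqVlt; apply/orP; left; apply/eqP.
congr (`| _ |)%E; apply: ae_eq_integral => //; [exact: mfg|exact: mfg|].
by apply: filterS cc' => x -> _.
Qed.

End weakstar.

(* Countably many boxes [c < q] with rational [q] and [\sum q < 1] exhaust the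
   uncovered set, and on each of them the cover defect is negative. *)
Lemma frac_cover_of_defect {d : measure_display} {T : measurableType d}
    {R : realType} {k : nat} (P : probability T R) (F : rel 'I_k)
    (W : T * T -> R) (c : T -> R) :
  unit_measurable W -> unit_measurable c ->
  (forall A : 'I_k -> set T, (forall l, measurable (A l)) ->
    0 <= \int[tuple_probability P k]_t (hom_density_fun F W t * box_indic A t *
                   (\sum_(l < k) c (tnth t l) - 1))) ->
  frac_cover P F W c.
Proof.
move=> uW uc def; have [mc c01] := uc; split=> //.
rewrite tuple_probabilityE; last exact: measurable_uncovered.
apply/negligibleP; first exact: measurable_uncovered.
pose box (q : {ffun 'I_k -> rat}) (l : 'I_k) := [set x | c x < ratr (q l)].
(* Rational vectors are enumerated through [pickle]; an [n] that codes none, or one of sum at least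
   1, gives the empty set. *)
pose S (n : nat) : set (k.-tuple T) := [set t | exists q : {ffun 'I_k -> rat},
  [/\ unpickle n = Some q, \sum_l ratr (q l) < 1 :> R,
      hom_density_fun F W t != 0 & forall l, box q l (tnth t l)]].
apply: (@negligibleS _ _ _ _ (\bigcup_n S n)).
  move=> t [/= Wt ct].
  (* The slack is divided by [k + 1]: adding [e] to each of the [k] values keeps the sum strictly
     below 1, also for [k = 0]. *)
  pose e := (1 - \sum_(i < k) c (tnth t i)) / k.+1%:R.
  have e0 : 0 < e by rewrite divr_gt0// subr_gt0.
  have /choice[q qP] : forall l : 'I_k, exists q : rat,
      c (tnth t l) < ratr q < c (tnth t l) + e.
    move=> l; have : c (tnth t l) < c (tnth t l) + e by rewrite ltrDl.
    by move=> /rat_in_itvoo[r]; rewrite in_itv; exists r.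
  exists (pickle [ffun l => q l]) => //; exists [ffun l => q l]; split=> //.
  - by rewrite pickleK.
  - apply: (@le_lt_trans _ _ (\sum_(l < k) (c (tnth t l) + e))).
      by apply: ler_sum => l _; rewrite ffunE; have /andP[_ /ltW] := qP l.
    rewrite big_split /= sumr_const card_ord -ltrBrDl -mulr_natr /e.
    rewrite -mulrA gtr_pMr ?subr_gt0// mulrC ltr_pdivrMr// mul1r.
    by rewrite ltr_nat.
  - by move=> l; rewrite /box /= ffunE; have /andP[] := qP l.
apply: negligible_bigcup => n.
have [[q [nq q1]]|nq] := pselect (exists q : {ffun 'I_k -> rat},
    unpickle n = Some q /\ \sum_l ratr (q l) < 1 :> R); last first.
  apply: negligibleS (negligible_set0 _) => t [q [nq' q1 _ _]].
  by apply: nq; exists q.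
have mbox l : measurable (box q l).
  rewrite -[X in measurable X]setTI.
  have := measurable_fun_ltr mc (measurable_cst (ratr (q l) : R)).
  by move=> /(_ measurableT [set true]); exact.
pose f t := hom_density_fun F W t * box_indic (box q) t.
have uf : unit_measurable f by apply: umM; [exact: um_hom_density|exact: um_box_indic].
have bf := umW _ uf.
(* On the box each [c] value is below its [q]; off the box both sides vanish. *)
have le_def t : f t * (\sum_(l < k) c (tnth t l) - 1) <=
    (\sum_(l < k) ratr (q l) - 1) * f t.
  have /andP[f0 _] := uf.2 t.
  have [tq|tq] := pselect (forall l, box q l (tnth t l)).
    rewrite mulrC ler_wpM2r// lerD2r; apply: ler_sum => l _.
    exact/ltW/tq.
  by rewrite /f box_indic0// !(mulr0, mul0r).
have bdef : bounded_measurable (fun t => f t * (\sum_(l < k) c (tnth t l) - 1)).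
  by apply: bmM => //; apply: bmB; [exact/bm_sum_tnth/umW|exact: bm_cst].
have intf0 : \int[tuple_probability P k]_t f t = 0.
  apply/eqP; rewrite eq_le; apply/andP; split; last first.
    by apply: Rintegral_ge0 => t _; have /andP[] := uf.2 t.
  (* This yields that [\sum q - 1], which is negative, times the integral of [f] is nonnegative, so
     that integral is at most 0. *)
  have := le_trans (def _ mbox) (bm_le_Rintegral (tuple_probability P k) _ _
    bdef (bmM _ _ (bm_cst _) bf) le_def).
  by rewrite bm_RintegralZl// nmulr_rge0// subr_lt0.
have mf : measurable_fun setT (EFin \o f) by apply/measurable_EFinP; exact: bf.1.
have intf0' : (\int[tuple_probability P k]_t `|(EFin \o f) t| = 0)%E.
  transitivity (\int[tuple_probability P k]_t (f t)%:E)%E.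
    apply: eq_integral => t _ /=; rewrite ger0_norm//.
    by have /andP[] := uf.2 t.
  by rewrite -bm_EFin_Rintegral// intf0.
have f_ae := (ae_eq_integral_abs _ measurableT mf).1 intf0'.
apply: negligibleS f_ae => t [q' [nq' _ Wt tq]] /= /(_ Logic.I) [].
move: nq'; rewrite nq => -[qq']; rewrite -qq' in tq.
by rewrite /f box_indic1// mulr1 => /eqP; rewrite (negbTE Wt).
Qed.

(** An element of the dual of L^1 is a class modulo null sets, whereas [frac_cover] bounds its
    function at every point; the conclusion therefore provides a representative [c'] of the class of
    [c]. *)
Theorem theorem3p14 (d : measure_display) (T : measurableType d)
  (R : realType) (P : probability T R) (k : nat) (F : rel 'I_k)
  (Ws : nat -> T * T -> R) (W : T * T -> R)
  (cs : nat -> T -> R) (c : T -> R) :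
  atomless P -> is_graph F ->
  (forall n, graphon (Ws n)) -> graphon W ->
  (fun n => cut_norm P (fun z => Ws n z - W z)) @ \oo --> 0%E ->
  (forall n, frac_cover P F (Ws n) (cs n)) ->
  Linfty P c -> weakstar_accumulation P cs c ->
  exists c' : T -> R, {ae P, forall x, c' x = c x} /\ frac_cover P F W c'.
Proof.
move=> _ _ gWs [mW _ W01] cutW covs [mc _] wc.
have uWs n : unit_measurable (Ws n) by have [mWn _ Wn01] := gWs n.
have ucs n : unit_measurable (cs n) by have [mcn cn01 _] := covs n.
have uW : unit_measurable W by [].
(* Clamping to the unit interval alters [c] only on the null set where it leaves that interval. *)
pose c' x := Num.max 0 (Num.min 1 (c x)).
have uc' : unit_measurable c'.
  split; last by move=> x; rewrite le_max lexx ge_max ler01 ge_min lexx.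
  by apply: measurable_maxr => //; exact: measurable_minr.
have c'c : {ae P, forall x, c' x = c x}.
  apply: filterS (weakstar_accumulation_unit _ _ _ ucs mc wc) => x /andP[c0 c1].
  by rewrite /c' (min_idPr c1) (max_idPr c0).
exists c'; split=> //; apply: frac_cover_of_defect => // A mA.
apply: (cover_defect_ge0 _ _ _ _ cs) => //.
by apply: (weakstar_accumulation_ae _ _ c) => // [n|]; [exact: (ucs n).1|exact: uc'.1].
Qed.
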